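(* Let $m>1$, $D>0$ and $r\ge 0$, and let $b,d$ satisfy the standing assumptions below. Let $c_0>0$ and the sharp wave solutions $\phi$ of speed $c_0$ be those given by the following existence result: there exists $c_0=c_0(m,r,b,d)>0$ such that the wave profile equation $$c\phi'(t)=D(\phi^m)''(t)-d(\phi(t))+b(\phi(t-cr)),\qquad t\in\mathbb R,$$ with $c=c_0$ admits a sharp wave solution $\phi$ with $\phi\equiv0$ on $(-\infty,0]$, $\phi>0$ on $(0,\infty)$, $\zeta_1\le\liminf_{t\to+\infty}\phi\le\limsup_{t\to+\infty}\phi\le\zeta_2$, and $|\phi(t)-C_1t^{1/(m-1)}|\le C_2t^{\Lambda}$ on $(0,1)$ for some $\Lambda>1/(m-1)$, $C_1,C_2>0$. Then: if $m\ge2$, these sharp waves are of non-$C^1$ type; if $1<m<2$, these sharp waves are of $C^1$ type.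
   Context: Standing assumptions: the death rate $d\in C^2([0,+\infty))$ satisfies $d(0)=0$, $d'(s)>0$ and $d''(s)\ge0$ for $s>0$. The birth rate $b\in C^1([0,+\infty);[0,+\infty))$ has exactly one positive local extremum point $s_M$, which is its global maximum point; $b(0)=0$; there is $\kappa>0$ with $b(\kappa)=d(\kappa)$; $b'(0)>d'(0)$; $b'(\kappa)<d'(\kappa)$; and $d(s)<b(s)\le b'(0)s$ for $s\in(0,\kappa)$. Moreover $s_M<\kappa$. Set $M:=b(s_M)$, $\zeta_2:=d^{-1}(M)$, $\theta:=b(\zeta_2)$, and let $\zeta_1\in(0,s_M)$ be the unique point with $b(\zeta_1)=\theta$. Definitions: a function $0\le\phi\in W^{1,1}_{\rm loc}(\mathbb R)\cap L^\infty(\mathbb R)$ with $\phi^m\in W^{1,1}_{\rm loc}(\mathbb R)$ is a semi-wavefront (of speed $c>0$) if (i) it satisfies the wave profile equation in the sense of distributions; (ii) $\phi(-\infty)=0$ and $0<\liminf_{t\to+\infty}\phi\le\limsup_{t\to+\infty}\phi<+\infty$; (iii) there is a maximal interval $(-\infty,t_0)$, $t_0\in(-\infty,+\infty]$, on which $\phi$ is monotonically increasing, and if $t_0<+\infty$ then $\phi(t_0)>\kappa$. A wavefront is a semi-wavefront with $\phi(+\infty)=\kappa$; a wave solution is either. It is sharp if there is $t_*$ with $\phi=0$ on $(-\infty,t_*]$ and $\phi>0$ on $(t_*,\infty)$. A sharp wave is of non-$C^1$ type if $\phi''\notin L^1_{\rm loc}(\mathbb R)$ and of $C^1$ type if $\phi''\in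 L^1_{\rm loc}(\mathbb R)$. *)

(* Defs.v *)
From HB Require Import structures.
From mathcomp Require Import all_boot all_order all_algebra.
From mathcomp Require Import all_classical all_reals all_analysis.
Set Implicit Arguments. Unset Strict Implicit. Unset Printing Implicit Defensive.
Import Order.TTheory GRing.Theory Num.Theory.
Import numFieldNormedType.Exports.
Local Open Scope classical_set_scope.
Local Open Scope ring_scope.

Section Defs.
Variable R : realType.
Local Notation mu := (@lebesgue_measure R).

Definition loc_int (f : R -> R) : Prop :=
  forall a b : R, mu.-integrable `[a, b] (EFin \o f).

Definition test_fun (psi : R -> R) : Prop :=
  (forall (n : nat) (x : R), derivable (derive1n n psi) x 1) /\
  (exists K : R, forall x : R, K < `|x| -> psi x = 0).

Definition weak_deriv (f g : R -> R) : Prop :=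
  forall psi, test_fun psi ->
    \int[mu]_(x in setT) (f x * derive1 psi x) =
    - \int[mu]_(x in setT) (g x * psi x).

Definition W11loc (f : R -> R) : Prop :=
  loc_int f /\ exists g, loc_int g /\ weak_deriv f g.

Definition second_deriv_L1loc (f : R -> R) : Prop :=
  exists g, loc_int g /\
    forall psi, test_fun psi ->
      \int[mu]_(x in setT) (f x * derive1n 2 psi x) =
      \int[mu]_(x in setT) (g x * psi x).

Definition liminf_pinfty (f : R -> R) : \bar R :=
  limf_einf (fun t => (f t)%:E) (pinfty_nbhs R).
Definition limsup_pinfty (f : R -> R) : \bar R :=
  limf_esup (fun t => (f t)%:E) (pinfty_nbhs R).

(* c phi' = D (phi^m)'' - d(phi) + b(phi(t - c r)) in the sense of distributions *)
Definition wave_eq (m D r c : R) (b d : R -> R) (phi : R -> R) : Prop :=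
  forall psi, test_fun psi ->
    - c * \int[mu]_(x in setT) (phi x * derive1 psi x) =
      D * \int[mu]_(x in setT) ((phi x `^ m) * derive1n 2 psi x)
      - \int[mu]_(x in setT) (d (phi x) * psi x)
      + \int[mu]_(x in setT) (b (phi (x - c * r)) * psi x).

Definition nondecr_before (phi : R -> R) (t : R) : Prop :=
  forall x y : R, x <= y -> y < t -> phi x <= phi y.

(* semi-wavefront of speed c (phi is identified with its continuous representative) *)
Definition semi_wavefront (m D r c kappa : R) (b d : R -> R) (phi : R -> R) : Prop :=
  (forall t, 0 <= phi t) /\ continuous phi /\
  (exists B : R, forall t, phi t <= B) /\
  W11loc phi /\ W11loc (fun t => phi t `^ m) /\
  wave_eq m D r c b d phi /\
  (phi t @[t --> -oo] --> 0) /\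
  (0 < liminf_pinfty phi)%E /\
  (liminf_pinfty phi <= limsup_pinfty phi)%E /\
  (limsup_pinfty phi < +oo)%E /\
  (* (iii) maximal interval (-oo, t0) of monotonicity; t0 = +oo or phi t0 > kappa *)
  ((forall t, nondecr_before phi t) \/
   (exists t0 : R, nondecr_before phi t0 /\
      (forall t1, t0 < t1 -> ~ nondecr_before phi t1) /\ kappa < phi t0)).

Definition sharp (phi : R -> R) : Prop :=
  exists ts : R, (forall t, t <= ts -> phi t = 0) /\ (forall t, ts < t -> 0 < phi t).

Definition sharp_nonC1_type (phi : R -> R) : Prop := sharp phi /\ ~ second_deriv_L1loc phi.
Definition sharp_C1_type (phi : R -> R) : Prop := sharp phi /\ second_deriv_L1loc phi.

(* f is C^1 on [0,+oo) with derivative f1 (f1(0) = right derivative, by continuity) *)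
Definition C1_on_halfline (f f1 : R -> R) : Prop :=
  {within `[0, +oo[, continuous f} /\ {within `[0, +oo[, continuous f1} /\
  (forall x : R, 0 < x -> is_derive x 1 f (f1 x)).

Definition local_max (f : R -> R) (s : R) : Prop :=
  exists2 e : R, 0 < e & forall y, 0 < y -> `|y - s| < e -> f y <= f s.
Definition local_min (f : R -> R) (s : R) : Prop :=
  exists2 e : R, 0 < e & forall y, 0 < y -> `|y - s| < e -> f s <= f y.

End Defs.

(* Main.v *)
Require Import Defs.
From HB Require Import structures.
From mathcomp Require Import all_boot all_order all_algebra.
From mathcomp Require Import all_classical all_reals all_analysis.
From mathcomp Require Import measurable_realfun ring lra.
Set Implicit Arguments. Unset Strict Implicit. Unset Printing Implicit Defensive.
Import Order.TTheory GRing.Theory Num.Theory.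
Import numFieldNormedType.Exports.
Local Open Scope classical_set_scope.
Local Open Scope ring_scope.

(** Write [alpha = 1 / (m - 1)], so that [phi ~ C1 t^alpha] at the edge [0] of the support.

If [m >= 2] then [alpha <= 1] and [phi t >= A t] near [0].  Were [phi'' = g] locally integrable, testing with [psi (x / e)], where [psi'' >= 0] on the right half-line, would give a left-hand side bounded below by a positive constant and a right-hand side bounded by the mass of [g] on an interval of length [O(e)]; the latter tends to [0].

If [m < 2] then, since both sides vanish on the left half-line, the distributional equation integrates to [D (phi^m)' = c phi + H] with [H' = d(phi) - b(phi(. - c r))].  Hence on [(0, +oo)] the profile is twice differentiable with [phi' = (c phi + H) phi^(1-m) / (D m) = O(t^(alpha-1))] and [phi'' = O(t^(alpha-2))], which is integrable at [0] because [alpha > 1], and [phi'(0+) = 0] leaves no singular part at the origin. *)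

(** * Smooth bump functions *)

Section smooth.
Context {R : realType}.
Implicit Types (f g : R -> R) (n : nat).

(** Derivatives enter as witnesses, so closure under sums, products and affine substitution is a
    plain induction, with no formula for iterated derivatives. *)
Fixpoint Cn n f : Prop :=
  if n is n'.+1 then
    exists2 f' : R -> R, forall x : R, is_derive x 1 f (f' x) & Cn n' f'
  else True.

Lemma CnP f : (forall n, Cn n f) ->
  forall n x, derivable (derive1n n f) x 1.
Proof.
move=> fs n.
suff H : forall k g, Cn k.+1 g -> forall x, derivable (derive1n k g) x 1.
  exact: H.
elim=> [|k IH] g [g' dg cg] x.
  by rewrite derive1n0; exact: (@ex_derive _ _ _ _ _ _ _ (dg x)).
have -> : derive1n k.+1 g = derive1n k g'.
  rewrite /derive1n iterSr; congr (iter _ _ _).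
  by apply/funext => y; rewrite derive1E; exact: (@derive_val _ _ _ _ _ _ _ (dg y)).
exact: IH.
Qed.

Lemma CnW n f : Cn n.+1 f -> Cn n f.
Proof.
by elim: n f => [//|n IH] f [f' df cf]; exists f' => //; exact: IH.
Qed.

Lemma CnD n f g : Cn n f -> Cn n g -> Cn n (fun x => f x + g x).
Proof.
elim: n f g => [//|n IH] f g [f' df cf] [g' dg cg].
by exists (fun x => f' x + g' x); [move=> x; exact: is_deriveD | exact: IH].
Qed.

Lemma CnM n f g : Cn n f -> Cn n g -> Cn n (fun x => f x * g x).
Proof.
elim: n f g => [//|n IH] f g cf cg.
(* The product rule pairs each function with the derivative of the other, so [f] and [g] are needed
   at order [n] beside [f'] and [g']. *)
have cf0 := CnW cf; have cg0 := CnW cg.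
case: cf => [f' df cf]; case: cg => [g' dg cg].
exists (fun x => f x * g' x + g x * f' x).
  by move=> x; exact: is_deriveM.
by apply: CnD; exact: IH.
Qed.

Lemma Cn_cst n (a : R) : Cn n (fun=> a).
Proof.
elim: n a => [//|n IH] a.
by exists (fun=> 0) => // x; exact: is_derive_cst.
Qed.

Lemma is_derive_affine (a e x : R) : is_derive x 1 (fun y : R => a * y + e) a.
Proof.
have -> : (fun y : R => a * y + e) = (a \*: id) + cst e by apply/funext.
by apply: is_derive_eq; rewrite addr0 /GRing.scale/= mulr1.
Qed.

Lemma is_derive_comp_affine f (f' : R -> R) (a e x : R) :
  (forall x : R, is_derive x 1 f (f' x)) ->
  is_derive x 1 (fun y => f (a * y + e)) (a * f' (a * x + e)).
Proof.
move=> df; rewrite mulrC.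
by apply: (@is_derive1_comp _ f (fun y => a * y + e)); exact: is_derive_affine.
Qed.

Lemma Cn_comp_affine n f (a e : R) : Cn n f -> Cn n (fun x => f (a * x + e)).
Proof.
elim: n f => [//|n IH] f [f' df cf].
exists (fun x => a * f' (a * x + e)).
  by move=> x; exact: is_derive_comp_affine.
by apply: CnM; [exact: Cn_cst | exact: IH].
Qed.

Lemma is_derive_continuous f (f' : R -> R) :
  (forall x : R, is_derive x 1 f (f' x)) -> continuous f.
Proof.
move=> df x; apply: differentiable_continuous; apply/derivable1_diffP.
exact: (@ex_derive _ _ _ _ _ _ _ (df x)).
Qed.

(** [flat 1] is the classical flat function e^(-1/x); the polynomial factor in 1/x makes the family
    stable under differentiation. *)
Definition flat (p : {poly R}) (x : R) : R :=
  if 0 < x then p.[x^-1] * expR (- x^-1) else 0.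

Lemma horner_growth (p : {poly R}) : exists2 C : R, 0 <= C &
  forall y, 1 <= y -> `|p.[y]| <= C * y ^+ size p.
Proof.
elim/poly_ind: p => [|p c [C C0 HC]].
  by exists 0 => // y _; rewrite horner0 normr0 mul0r.
have [p0|p0] := eqVneq p 0.
  exists `|c| => // y y1; rewrite p0 mul0r add0r hornerC.
  by rewrite ler_peMr// exprn_ege1.
exists (C + `|c|) => [|y y1]; first by rewrite addr_ge0.
rewrite size_MXaddC (negbTE p0)/= hornerMXaddC mulrDl exprS.
apply: (le_trans (ler_normD _ _)); apply: lerD.
  rewrite normrM mulrCA mulrC (ger0_norm (le_trans ler01 y1)).
  by apply: ler_wpM2l; [exact: (le_trans ler01 y1)|exact: HC].
by rewrite ler_peMr// -exprS exprn_ege1.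
Qed.

(** With y = 1/x and n = [size p], the Taylor term y^(n+2)/(n+2)! below e^y beats the growth C y^n
    of p(y) and leaves x^2 to spare, which forces a zero derivative at 0. *)
Lemma flat_bound (p : {poly R}) : exists2 C : R, 0 <= C &
  forall x, `|x| <= 1 -> `|flat p x| <= C * x ^+ 2.
Proof.
have [C C0 HC] := horner_growth p.
pose n := size p.
exists (C * n.+2`!%:R) => [|x]; first by rewrite mulr_ge0.
rewrite /flat; case: ifPn => [x0 x1|_ _]; last first.
  by rewrite normr0; apply: mulr_ge0; [exact: mulr_ge0|exact: sqr_ge0].
rewrite gtr0_norm// in x1.
pose y := x^-1.
have y1 : 1 <= y by rewrite /y invf_ge1.
have y0 : 0 < y by rewrite invr_gt0.
rewrite -/y normrM (ger0_norm (expR_ge0 _)) expRN.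
have ge : y ^+ n.+2 / n.+2`!%:R <= expR y.
  have := @expR_ge1Dxn R y n.+1 (ltW y0); lra.
have f0 : 0 < n.+2`!%:R :> R by rewrite ltr0n fact_gt0.
rewrite ler_pdivrMr ?expR_gt0//.
apply: (le_trans (HC _ y1)).
have -> : C * y ^+ n = C * n.+2`!%:R * x ^+ 2 * (y ^+ n.+2 / n.+2`!%:R).
  have -> : x = y^-1 by rewrite /y invrK.
  rewrite !exprS; field.
  by rewrite !gt_eqF// ltr0n fact_gt0.
apply: ler_wpM2l => //.
by apply: mulr_ge0; [exact: mulr_ge0|exact: sqr_ge0].
Qed.

Lemma is_derive0_quadratic f (C : R) : f 0 = 0 ->
  (forall x, `|x| <= 1 -> `|f x| <= C * x ^+ 2) -> is_derive (0 : R) (1 : R) f 0.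
Proof.
move=> f0 Hf.
have H : h^-1 *: (f (h *: 1 + 0) - f 0) @[h --> (0:R)^'] --> (0 : R).
  have C0 : 0 <= C.
    by have := Hf 1; rewrite normr1 expr1n mulr1 => /(_ (lexx _)); exact: le_trans.
  apply/cvgr0Pnorm_le => e e0.
  have : \forall h \near (0:R)^', `|h| <= Num.min 1 (e / (C + 1)).
    apply: dnbhs0_le; rewrite lt_min ltr01/= divr_gt0//; lra.
  have : \forall h \near (0:R)^', h != 0 by exact: nbhs_dnbhs_neq.
  apply: filterS2 => h h0; rewrite le_min => /andP[h1 he].
  rewrite f0 subr0 addr0 /GRing.scale/= mulr1 normrM normfV.
  rewrite ler_pdivrMl ?normr_gt0//.
  apply: (le_trans (Hf _ h1)).
  rewrite -[h ^+ 2]real_normK ?num_real// expr2.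
  rewrite mulrCA ler_wpM2l//.
  rewrite ler_pdivlMr in he; last lra.
  rewrite mulrC; apply: le_trans he; rewrite ler_wpM2l//; lra.
split; last exact: cvg_lim.
by apply/cvg_ex; exists 0.
Qed.

(** Differentiating p(1/x) or e^(-1/x) brings out a factor x^(-2), which is ['X^2] evaluated at 1/x.
    At 0 the quadratic bound takes over. *)
Lemma flat_derive (p : {poly R}) (x : R) :
  is_derive x 1 (flat p) (flat ('X^2 * (p - p^`())) x).
Proof.
have [x0|x0|->] := ltgtP x 0.
- have -> : flat ('X^2 * (p - p^`())) x = 0 by rewrite /flat ltNge (ltW x0).
  apply: (@near_eq_is_derive _ _ _ (cst 0)).
  + near=> z; rewrite /flat ltNge ltW//.
  by near: z; exact: lt_nbhsl.
- rewrite /flat x0.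
  apply: (@near_eq_is_derive _ _ _ (fun y : R => p.[y^-1] * expR (- y^-1))).
  + near=> z; rewrite /flat ifT//.
    by near: z; exact: lt_nbhsr.
  have xn0 : x != 0 by rewrite gt_eqF.
  have dV : is_derive x 1 (fun y : R => y^-1) (- x ^- 2).
    by apply: is_derive_eq; [exact: is_deriveV|rewrite /GRing.scale/= mulr1].
  have dNV : is_derive x 1 (fun y : R => - y^-1) (x ^- 2).
    by apply: (is_derive_eq (is_deriveN dV)); rewrite opprK.
  have d1 : is_derive x 1 (fun y : R => p.[y^-1]) (p^`().[x^-1] * - x ^- 2).
    exact: (@is_derive1_comp _ (horner p) (fun y => y^-1)).
  have d2 : is_derive x 1 (fun y : R => expR (- y^-1)) (expR (- x^-1) * x ^- 2).
    exact: (@is_derive1_comp _ expR (fun y => - y^-1)).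
  apply: (is_derive_eq (is_deriveM d1 d2)).
  by rewrite /GRing.scale/= hornerM hornerXn hornerD hornerN; field.
- have -> : flat ('X^2 * (p - p^`())) 0 = 0 by rewrite /flat ltxx.
  have [C _ HC] := flat_bound p.
  by apply: (is_derive0_quadratic _ HC); rewrite /flat ltxx.
Unshelve. all: by end_near. Qed.

Lemma Cn_flat n (p : {poly R}) : Cn n (flat p).
Proof.
elim: n p => [//|n IH] p.
by exists (flat ('X^2 * (p - p^`()))) => // x; exact: flat_derive.
Qed.

(** The explicit coefficients keep both factors in the shape treated by [Cn_comp_affine]. *)
Definition bump (x : R) : R := flat 1 (1 * x + 1) * flat 1 (-1 * x + 1).

Lemma Cn_bump n : Cn n bump.
Proof. by apply: CnM; apply: Cn_comp_affine; exact: Cn_flat. Qed.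

Lemma bump_continuous : continuous bump.
Proof. by have [f' df _] := Cn_bump 1; exact: is_derive_continuous df. Qed.

Lemma flat1_gt0 x : 0 < x -> 0 < flat 1 x.
Proof. by rewrite /flat => ->; rewrite hornerC mul1r expR_gt0. Qed.

Lemma flat_le0 p x : x <= 0 -> flat p x = 0.
Proof. by rewrite /flat leNgt => /negbTE ->. Qed.

Lemma bump_gt0 x : -1 < x < 1 -> 0 < bump x.
Proof. by move=> x1; rewrite /bump mulr_gt0// flat1_gt0//; lra. Qed.

Lemma bump_eq0 x : x <= -1 \/ 1 <= x -> bump x = 0.
Proof.
rewrite /bump => -[x1|x1].
  by rewrite flat_le0 ?mul0r//; lra.
by rewrite [X in _ * X]flat_le0 ?mulr0//; lra.
Qed.

Lemma bump_ge0 x : 0 <= bump x.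
Proof.
have [x1|x1] := leP x (-1); first by rewrite bump_eq0//; left.
have [x2|x2] := leP 1 x; first by rewrite bump_eq0//; right.
by apply/ltW/bump_gt0; rewrite x1.
Qed.

Lemma bump_lower_bound : exists2 beta : R, 0 < beta &
  forall x, `|x| <= 2^-1 -> beta <= bump x.
Proof.
have [||x0 x0P x0min] := @EVT_min R bump (- 2^-1) 2^-1.
- lra.
- exact: continuous_subspaceT bump_continuous.
exists (bump x0); first by apply: bump_gt0; move: x0P; rewrite in_itv/=; lra.
by move=> x; rewrite ler_norml => xP; apply: x0min; rewrite in_itv.
Qed.

Lemma continuous_bump_affine (a e : R) : continuous (fun x : R => bump (a * x - e)).
Proof.
have [b' db _] := Cn_bump 1.
exact: (is_derive_continuous (fun x => is_derive_comp_affine a (- e) x db)).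
Qed.

End smooth.

(** * Integration against test functions *)

Section integration.
Context {R : realType}.
Local Notation mu := (@lebesgue_measure R).
Implicit Types (f g F G : R -> R).

Lemma is_derive_unique f (x a b : R) :
  is_derive x 1 f a -> is_derive x 1 f b -> a = b.
Proof. by move=> [_ <-] [_ <-]. Qed.

Lemma is_derive_near0 F (x y : R) : is_derive x 1 F y ->
  (\forall z \near x, F z = 0) -> y = 0.
Proof.
move=> dF F0; apply: (is_derive_unique dF).
apply: (@near_eq_is_derive _ _ _ (cst 0)).
by apply: filterS F0 => z ->.
Qed.

Lemma is_derive_supp F f (K : R) : (forall x : R, is_derive x 1 F (f x)) ->
  (forall x, K < `|x| -> F x = 0) -> forall x, K < `|x| -> f x = 0.
Proof.
move=> dF F0 x Kx; apply: (is_derive_near0 (dF x)).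
have : \forall z \near x, K < `|z|.
  have := @norm_continuous _ R^o x; move/cvgr_gt; exact.
by apply: filterS => z; exact: F0.
Qed.

Lemma continuous_integrable_itv f (a b : R) : continuous f ->
  mu.-integrable `[a, b] (EFin \o f).
Proof.
move=> cf; apply: continuous_compact_integrable; first exact: segment_compact.
exact: continuous_subspaceT.
Qed.

Lemma patch_supp f (A B : set R) : A `<=` B ->
  (forall x, B x -> ~ A x -> f x = 0) -> f \_ B = f \_ A.
Proof.
move=> AB f0; apply/funext => x; rewrite !patchE.
have [/set_mem Ax|/negP nAx] := boolP (x \in A).
  by rewrite (mem_set (AB _ Ax)).
case: ifPn => // /set_mem Bx; apply: f0 => // Ax.
by apply: nAx; exact: mem_set.
Qed.

Lemma integrable_supp f (A B : set (measurableTypeR R)) : measurable A -> measurable B ->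
  A `<=` B -> (forall x, B x -> ~ A x -> f x = 0) ->
  mu.-integrable A (EFin \o f) -> mu.-integrable B (EFin \o f).
Proof.
move=> mA mB AB f0 fi.
have fA := (integrable_mkcond _ mA).1 fi.
apply: (integrable_mkcond _ mB).2.
by move: fA; rewrite !restrict_EFin (patch_supp AB f0).
Qed.

Lemma Rintegral_supp f (A B : set (measurableTypeR R)) :
  A `<=` B -> (forall x, B x -> ~ A x -> f x = 0) ->
  \int[mu]_(x in B) f x = \int[mu]_(x in A) f x.
Proof. by move=> AB f0; rewrite Rintegral_mkcond [RHS]Rintegral_mkcond (patch_supp AB f0). Qed.

Lemma integrable_cpt f (K : R) : continuous f ->
  (forall x, K < `|x| -> f x = 0) -> mu.-integrable setT (EFin \o f).
Proof.
move=> cf f0; apply: (@integrable_supp f `[- K, K]) => //; last first.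
  exact: continuous_integrable_itv.
by move=> x _ /negP; rewrite /= in_itv/= -ler_norml -ltNge; exact: f0.
Qed.

(** Integrating over []-oo, x]] fixes the constant so that the primitive vanishes left of [a].
    Integrability reduces to a compact interval, since [f] is zero before [a]. *)
Lemma antiderivative_left f (a : R) : continuous f ->
  (forall x, x <= a -> f x = 0) ->
  exists2 F : R -> R, forall x : R, is_derive x 1 F (f x) & forall x, x <= a -> F x = 0.
Proof.
move=> cf f0; exists (fun x => \int[mu]_(t in `]-oo, x]) f t).
  move=> x.
  have xx1 : x < x + 1 by lra.
  have fi : mu.-integrable `]-oo, x + 1] (EFin \o f).
    apply: (@integrable_supp f `[a, x + 1]) => //.
    - by move=> y; rewrite /= !in_itv/= => /andP[].
    - move=> y; rewrite /= !in_itv/= => yx /negP.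
      by rewrite yx andbT -ltNge => /ltW; exact: f0.
    - exact: continuous_integrable_itv.
  have [|dF F'] := continuous_FTC1 xx1 fi _ (cf x); first by rewrite ltNyr.
  by split => //; rewrite -derive1E.
move=> x xa; rewrite (@eq_Rintegral _ _ _ _ _ (cst 0)).
  by rewrite Rintegral_cst// mul0r.
by move=> y; rewrite inE/= in_itv/= => yx; apply: f0; exact: le_trans yx xa.
Qed.

Lemma is_derive_within F f (a b : R) : (forall x : R, is_derive x 1 F (f x)) ->
  derivable_oo_LRcontinuous F a b.
Proof.
move=> dF; have cF := is_derive_continuous dF; split.
- by move=> x _; have [] := dF x.
- exact/cvg_at_right_filter/cF.
- exact/cvg_at_left_filter/cF.
Qed.

Lemma Rintegral_derive_cpt F f (K : R) : (forall x : R, is_derive x 1 F (f x)) ->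
  continuous f -> (forall x, K < `|x| -> F x = 0) -> \int[mu]_x f x = 0.
Proof.
move=> dF cf F0; have f0 := is_derive_supp dF F0.
(* [K] may be negative; [L] is positive and lies strictly beyond the support. *)
pose L := `|K| + 1.
have KL : K < L by rewrite /L (le_lt_trans (ler_norm K))// ltrDl.
have L0 : 0 < L by rewrite /L ltr_wpDl.
rewrite (@Rintegral_supp f `[- L, L])//; last first.
  move=> x _ /negP; rewrite /= in_itv/= -ler_norml -ltNge => Lx.
  by apply: f0; exact: lt_trans Lx.
have LL : - L < L by lra.
rewrite /Rintegral (@continuous_FTC2 _ f F)//=.
- by rewrite !F0 ?subrr// ?normrN gtr0_norm.
- exact: continuous_subspaceT.
- exact: is_derive_within dF.
- by move=> x _; rewrite derive1E; have [] := dF x.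
Qed.

(* [P] is a second difference of an iterated antiderivative of [bump]: the linear parts cancel, which makes the support compact. *)
Lemma tent_test (rho : R) : 1 <= rho ->
  exists P : R -> R, [/\ exists M, forall x, `|P x| <= M,
    exists K, forall x, K < `|x| -> P x = 0 &
    forall e, 0 < e -> test_fun (fun x => P (e^-1 * x)) /\
      forall x, 0 < x -> derive1n 2 (fun x => P (e^-1 * x)) x =
                e ^- 2 * bump (e^-1 * x - rho)].
Proof.
move=> rho1.
(* [E] is a smooth step and [k] below a smooth ramp: both vanish left of -1, and [k] is affine with
   slope [E 1] right of 1. *)
have [E dE E0] := @antiderivative_left bump (-1) bump_continuous
  (fun x h => bump_eq0 (or_introl h)).
have [k dk k0] := @antiderivative_left E (-1) (is_derive_continuous dE) E0.
have cst_right F f (x y : R) : (forall x : R, is_derive x 1 F (f x)) ->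
    (forall x, 1 <= x -> f x = 0) -> 1 <= x -> 1 <= y -> F x = F y.
  move=> dF f0; wlog xy : x y / x <= y.
    by move=> H x1 y1; case/orP: (le_total x y) => xy; [|apply/esym]; exact: H.
  move=> x1 y1.
  have [|c cxy] := @MVT_segment _ F f x y xy (fun z _ => dF z).
    exact: continuous_subspaceT (is_derive_continuous dF).
  rewrite f0 ?mul0r; first lra.
  by move: cxy; rewrite in_itv/= => /andP[xc _]; lra.
have E1 x : 1 <= x -> E x = E 1.
  by move=> x1; apply: (cst_right E bump) => // y y1; apply: bump_eq0; right.
have k1 x : 1 <= x -> k x = k 1 + E 1 * (x - 1).
  move=> x1.
  have dl (y : R) : is_derive y 1 (fun y => k y - (E 1 * y + 0)) (E y - E 1).
    exact: (is_deriveB (dk y) (is_derive_affine (E 1) 0 y)).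
  have := cst_right _ _ x 1 dl; rewrite lexx => /(_ _ x1 isT).
  rewrite !addr0 mulr1 => H.
  suff : k x - E 1 * x = k 1 - E 1 by lra.
  by apply: H => y y1; rewrite (E1 _ y1) subrr.
have Cnk n : Cn n k.
  have : Cn n.+2 k by exists E => //; exists bump => //; exact: Cn_bump.
  by move=> /CnW /CnW.
(* The nodes -(2 + rho), -1 and rho are equally spaced, so affine functions are annihilated. The
   negative bump of P'' sits on [-2, 0], and for x > 0 only the bump centred at rho survives. *)
pose P (x : R) := k (1 * x + (2 + rho)) + (-2) * k (1 * x + 1) + k (1 * x + - rho).
pose P1 (x : R) := E (1 * x + (2 + rho)) + (-2) * E (1 * x + 1) + E (1 * x + - rho).
pose P2 (x : R) :=
  bump (1 * x + (2 + rho)) + (-2) * bump (1 * x + 1) + bump (1 * x + - rho).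
have CnPn n : Cn n P.
  apply: CnD; last exact: Cn_comp_affine.
  apply: CnD; first exact: Cn_comp_affine.
  by apply: CnM; [exact: Cn_cst|exact: Cn_comp_affine].
have dcomb F f (x : R) : (forall x : R, is_derive x 1 F (f x)) ->
  is_derive x 1 (fun x => F (1 * x + (2 + rho)) + (-2) * F (1 * x + 1) + F (1 * x + - rho))
    (f (1 * x + (2 + rho)) + (-2) * f (1 * x + 1) + f (1 * x + - rho)).
  move=> dF.
  have h (e : R) : is_derive x 1 (fun x => F (1 * x + e)) (f (1 * x + e)).
    by have := is_derive_comp_affine 1 e x dF; rewrite mul1r.
  exact: (is_deriveD (is_deriveD (h _) (is_deriveZ (-2) (h _))) (h _)).
have dP (x : R) : is_derive x 1 P (P1 x) by exact: dcomb.
have dP1 (x : R) : is_derive x 1 P1 (P2 x) by exact: dcomb.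
have supp x : rho + 3 < `|x| -> P x = 0.
  rewrite /P lter_normr => /orP[|] x1.
    rewrite (k1 (1 * x + (2 + rho))) ?(k1 (1 * x + 1)) ?(k1 (1 * x + - rho)); lra.
  by rewrite !k0; lra.
have cP := is_derive_continuous dP.
exists P; split.
- have [||c _ cM] := @EVT_max R (fun x => `|P x|) (- (rho + 3)) (rho + 3).
  + by lra.
  + apply: continuous_subspaceT => x; apply: cvg_norm; exact: cP.
  + exists `|P c| => x; have [xr|xr] := leP `|x| (rho + 3).
      by apply: cM; rewrite in_itv/= -ler_norml.
    by rewrite supp// normr0.
- by exists (rho + 3).
- move=> e e0; split; first split.
  + apply: CnP => n.
    have := @Cn_comp_affine _ n P e^-1 0 (CnPn n).
    by under eq_fun do rewrite addr0.
  + exists (e * (rho + 3)) => x xe; apply: supp.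
    by rewrite normrM gtr0_norm ?invr_gt0// ltr_pdivlMl.
  + move=> x x0.
    have d (F f : R -> R) : (forall x : R, is_derive x 1 F (f x)) ->
        derive1 (fun x => F (e^-1 * x)) = fun x => e^-1 * f (e^-1 * x).
      move=> dF; apply/funext => y; rewrite derive1E.
      have := is_derive_comp_affine e^-1 0 y dF.
      under eq_fun do rewrite addr0.
      by rewrite addr0 => -[_ ->].
    rewrite /derive1n/= (d _ _ dP).
    have -> : (fun x => e^-1 * P1 (e^-1 * x)) = (fun x => (e^-1 \*: P1) (e^-1 * x)).
      by [].
    rewrite (d _ (e^-1 \*: P2)).
    rewrite /= /GRing.scale/= mulrA -expr2 exprVn; congr (_ * _).
    have y0 : 0 < e^-1 * x by rewrite mulr_gt0// invr_gt0.
    rewrite /P2 mul1r [X in X + _ + _]bump_eq0; last by right; lra.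
    by rewrite [X in _ + _ * X + _]bump_eq0 ?mulr0 ?add0r//; right; lra.
Qed.

End integration.

(** * The case [m >= 2] *)

Section nonC1.
Context {R : realType}.
Local Notation mu := (@lebesgue_measure R).
Implicit Types (f g : R -> R).

Lemma Rintegral_ge_cst f (a b C : R) : a <= b ->
  mu.-integrable setT (EFin \o f) -> (forall x, 0 <= f x) ->
  (forall x, a <= x <= b -> C <= f x) -> C * (b - a) <= \int[mu]_x f x.
Proof.
move=> ab fi f0 fC.
have mab : fine (mu `[a, b]) = b - a.
  rewrite lebesgue_measure_itv/= lte_fin; case: ifPn => // ba.
  by have -> : a = b by [apply/le_anti; rewrite ab leNgt]; rewrite subrr.
rewrite -mab -Rintegral_cst// Rintegral_mkcond; apply: le_Rintegral => //.
- rewrite -restrict_EFin; apply/integrable_restrict => //; rewrite setTI.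
  by apply: continuous_integrable_itv => x; exact: cvg_cst.
- move=> x _; rewrite patchE; case: ifPn => // /set_mem /=.
  by rewrite in_itv/=; exact: fC.
Qed.

Lemma loc_int_mul_continuous f g (a b : R) :
  mu.-integrable `[a, b] (EFin \o f) -> continuous g ->
  mu.-integrable `[a, b] (EFin \o (fun x => f x * g x)).
Proof.
move=> fi cg; have := @integrableMl _ _ _ mu `[a, b] _ (EFin \o f) g fi.
apply => //.
- by apply: measurable_funTS; exact: continuous_measurable_fun.
- have : compact (g @` `[a, b]).
    apply: continuous_compact; last exact: segment_compact.
    exact: continuous_subspaceT.
  move=> /compact_bounded [M [Mr HM]]; exists M; split => // y My x abx.
  by apply: (HM _ My); exists x.
Qed.

Lemma test_fun_continuous (psi : R -> R) n : test_fun psi ->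
  continuous (derive1n n psi).
Proof.
move=> [d _] x; apply: differentiable_continuous; apply/derivable1_diffP.
exact: d.
Qed.

(** Scaling: on an interval of length [e] at distance of order [e] from 0, [phi] is at least of
    order [e] and psi'' of order e^(-2), so the powers of [e] cancel on the left. On the right psi
    stays bounded while its support shrinks. *)
Lemma not_second_deriv_L1loc (phi : R -> R) (A t0 : R) :
  continuous phi -> (forall t, t <= 0 -> phi t = 0) ->
  (forall t, 0 < t -> 0 < phi t) ->
  0 < A -> 0 < t0 -> (forall t, 0 < t < t0 -> A * t <= phi t) ->
  ~ second_deriv_L1loc phi.
Proof.
move=> cphi phi0 phi_gt0 A0 t00 phiA [g [gi Hg]].
(* With rho = 2 the rescaled bump lives on [e, 3e] and is at least e^(-2) [beta] on [3e/2, 5e/2]. *)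
have [|P [[M0 PM] [K0 PK] Ptest]] := @tent_test R 2; first by rewrite ler1n.
pose M := `|M0| + 1; pose K := `|K0| + 1.
have M_gt0 : 0 < M by rewrite ltr_wpDl.
have K_gt0 : 0 < K by rewrite ltr_wpDl.
have {}PM x : `|P x| <= M.
  by apply: (le_trans (PM x)); apply: (le_trans (ler_norm _)); rewrite lerDl.
have {}PK x : K < `|x| -> P x = 0.
  move=> Kx; apply: PK; apply: le_lt_trans Kx.
  by apply: (le_trans (ler_norm _)); rewrite lerDl.
have [beta beta0 Hbeta] := @bump_lower_bound R.
(* This is A (3e/2) times e^(-2) [beta] times the length e. *)
pose delta := A * (3 / 2) * beta.
have delta0 : 0 < delta by apply: mulr_gt0 => //; apply: mulr_gt0 => //; lra.
(* Truncation makes [g] globally integrable, as absolute continuity of the integral requires. *)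
pose G := g \_ `[- K, K].
have Gi : mu.-integrable setT (EFin \o G).
  rewrite /G -restrict_EFin; apply/integrable_restrict => //.
  by rewrite setTI; exact: gi.
have [e1 [e10 He1]] := integral_normr_continuous Gi (divr_gt0 delta0 M_gt0).
(* The bound 1 keeps the support [-Ke, Ke] inside [-K, K], where [G] equals [g]; t0/3 keeps
   [3e/2, 5e/2] where the linear lower bound holds; the last term makes 2Ke < e1. *)
pose e := Num.min (Num.min 1 (t0 / 3)) (e1 / (3 * K)).
have e0 : 0 < e.
  by rewrite !lt_min ltr01 !divr_gt0// mulr_gt0.
have e_le1 : e <= 1 by rewrite !ge_min lexx.
have e_t0 : e <= t0 / 3 by rewrite !ge_min lexx orbT.
have e_e1 : e <= e1 / (3 * K) by rewrite !ge_min lexx orbT.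
have [tpsi psi2] := Ptest e e0.
have := Hg _ tpsi.
set psi := (fun x => P (e^-1 * x)) in tpsi psi2 *.
pose F (x : R) := phi x * (e ^- 2 * bump (e^-1 * x - 2)).
(* [psi2] describes psi'' only for x > 0, which suffices because [phi] vanishes elsewhere. *)
have -> : \int[mu]_x (phi x * derive1n 2 psi x) = \int[mu]_x F x.
  apply: eq_Rintegral => x _; rewrite /F; have [x_le0|x_gt0] := leP x 0.
    by rewrite phi0// !mul0r.
  by rewrite psi2.
have lower : delta <= \int[mu]_x F x.
  have -> : delta = (A * (3 / 2 * e) * (e ^- 2 * beta)) * (5 / 2 * e - 3 / 2 * e).
    rewrite /delta; field; exact: lt0r_neq0.
  apply: Rintegral_ge_cst.
  - by rewrite ler_pM2r//; lra.
  - apply: (@integrable_cpt _ _ (3 * e)).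
      move=> x; apply: cvgM; first exact: cphi.
      by apply: cvgM; [exact: cvg_cst|exact: continuous_bump_affine].
    move=> x ex; rewrite /F bump_eq0 ?mulr0//.
    have : 3 < `|e^-1 * x|.
      by rewrite normrM gtr0_norm ?invr_gt0// ltr_pdivlMl// mulrC.
    rewrite lter_normr => /orP[|] h; [right|left]; lra.
  - move=> x; have [x_le0|x_gt0] := leP x 0; first by rewrite /F phi0// mul0r.
    apply: mulr_ge0; first exact/ltW/phi_gt0.
    by apply: mulr_ge0; [rewrite invr_ge0 exprn_ge0// ltW|exact: bump_ge0].
  - move=> x /andP[x1 x2].
    have x_gt0 : 0 < x by apply: lt_le_trans x1; rewrite mulr_gt0.
    apply: ler_pM.
    + by rewrite !mulr_ge0// ltW.
    + by rewrite mulr_ge0// ?invr_ge0 ?exprn_ge0// ltW.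
    + apply: (@le_trans _ _ (A * x)); first by rewrite ler_pM2l.
      by apply: phiA; rewrite x_gt0/=; lra.
    + rewrite ler_wpM2l ?invr_ge0 ?exprn_ge0 ?(ltW e0)//.
      apply: Hbeta; rewrite ler_norml.
      have : 3 / 2 <= e^-1 * x by rewrite ler_pdivlMl// mulrC.
      have : e^-1 * x <= 5 / 2 by rewrite ler_pdivrMl// mulrC.
      lra.
move=> Heq.
have psi_supp x : K * e < `|x| -> psi x = 0.
  move=> Kx; apply: PK.
  by rewrite normrM gtr0_norm ?invr_gt0// ltr_pdivlMl// mulrC.
have gpi : mu.-integrable `[- (K * e), K * e] (EFin \o (fun x => g x * psi x)).
  by apply: loc_int_mul_continuous; [exact: gi | exact: (@test_fun_continuous psi 0 tpsi)].
have upper : \int[mu]_x (g x * psi x) < delta.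
  rewrite (@Rintegral_supp _ _ `[- (K * e), K * e])//; last first.
    move=> x _ /negP; rewrite /= in_itv/= -ler_norml -ltNge => /psi_supp ->.
    by rewrite mulr0.
  apply: le_lt_trans (ler_norm _) _.
  apply: le_lt_trans (le_normr_Rintegral _ gpi) _ => //.
  have gie : mu.-integrable `[- (K * e), K * e] (EFin \o (fun x => `|g x|)).
    exact: (integrable_norm (gi _ _)).
  apply: (@le_lt_trans _ _ (\int[mu]_(x in `[- (K * e), K * e]) (M * `|g x|))).
    apply: le_Rintegral => //.
    - exact: (integrable_norm gpi).
    - exact: (integrableZl _ M gie).
    - by move=> x _; rewrite normrM mulrC ler_wpM2r//; exact: PM.
  rewrite RintegralZl// -ltr_pdivlMl// [M^-1 * _]mulrC.
    have -> : \int[mu]_(x in `[- (K * e), K * e]) `|g x| =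
      \int[mu]_(x in `[- (K * e), K * e]) `|G x|.
    apply: eq_Rintegral => x; rewrite inE/= in_itv/= => /andP[x1 x2].
    rewrite /G patchE ifT// inE/= in_itv/=.
    have : K * e <= K by rewrite ler_piMr// ltW.
    lra.
  apply: He1 => //.
  suff : (mu `[(- (K * e))%R, (K * e)%R] < e1%:E)%E by [].
  rewrite lebesgue_measure_itv/= lte_fin; case: ifPn => // _.
  rewrite -EFinB lte_fin.
  move: e_e1; rewrite ler_pdivlMr ?mulr_gt0// => e_e1.
  have : 0 < K * e by rewrite mulr_gt0.
  lra.
suff : \int[mu]_x F x < delta by rewrite ltNge lower.
by rewrite Heq; exact: upper.
Qed.

End nonC1.

(** * Weakly affine functions and singular integrals *)

Section tools.
Context {R : realType}.
Local Notation mu := (@lebesgue_measure R).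
Implicit Types (f g F G u : R -> R).

Lemma test_fun_derive (psi : R -> R) n (x : R) : test_fun psi ->
  is_derive x 1 (derive1n n psi) (derive1n n.+1 psi x).
Proof. by move=> [d _]; split => //; rewrite derive1nS derive1E. Qed.

Lemma test_fun_supp (psi : R -> R) : test_fun psi ->
  exists K, forall n x, K < `|x| -> derive1n n psi x = 0.
Proof.
move=> tpsi; have [_ [K HK]] := tpsi; exists K; elim=> [//|n IH].
by apply: is_derive_supp IH => x; exact: test_fun_derive.
Qed.

Lemma integrable_mul_test f (psi : R -> R) n : continuous f -> test_fun psi ->
  mu.-integrable setT (EFin \o (fun x => f x * derive1n n psi x)).
Proof.
move=> cf tpsi; have [K HK] := test_fun_supp tpsi.
apply: (@integrable_cpt _ _ K).
  by move=> x; apply: cvgM; [exact: cf|exact: test_fun_continuous].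
by move=> x /HK ->; rewrite mulr0.
Qed.

Lemma integration_by_parts_test F f (psi : R -> R) n :
  (forall x : R, is_derive x 1 F (f x)) -> continuous f -> test_fun psi ->
  \int[mu]_x (F x * derive1n n.+1 psi x) = - \int[mu]_x (f x * derive1n n psi x).
Proof.
move=> dF cf tpsi; have [K HK] := test_fun_supp tpsi.
have cF := is_derive_continuous dF.
apply/eqP; rewrite -addr_eq0 -RintegralD//; [|exact: integrable_mul_test..].
apply/eqP.
apply: (@Rintegral_derive_cpt _ (fun x => F x * derive1n n psi x) _ K).
- move=> x; apply: (is_derive_eq (is_deriveM (dF x) (test_fun_derive n x tpsi))).
  by rewrite /GRing.scale/= [X in _ + X]mulrC.
- move=> x; apply: cvgD; apply: cvgM; do ?[exact: cf|exact: cF];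
  exact: test_fun_continuous.
- by move=> x /HK ->; rewrite mulr0.
Qed.

(** If u(s) were nonzero, a test function whose second derivative on the right half-line is a narrow
    bump at s would give a nonzero integral; the rest of psi'' meets only zeros of [u]. *)
Lemma weak_affine_eq0 u : continuous u -> (forall t, t <= 0 -> u t = 0) ->
  (forall psi, test_fun psi -> \int[mu]_x (u x * derive1n 2 psi x) = 0) ->
  forall t, u t = 0.
Proof.
move=> cu u0 Hu s; have [s0|s0] := leP s 0; first exact: u0.
have [//|us0] := eqVneq (u s) 0; exfalso.
(* Multiplying by the constant u(s) makes v(s) = u(s)^2 positive whatever the sign of u(s). *)
pose v x := u s * u x.
have cv : continuous v by move=> x; apply: cvgM; [exact: cvg_cst|exact: cu].
have vs : 0 < v s by rewrite /v -expr2 exprn_even_gt0.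
pose eta := v s / 2.
have eta0 : 0 < eta by rewrite divr_gt0.
have : \forall x \near s, eta < v x.
  by have := cv s => /cvgr_gt; apply; rewrite /eta; lra.
move=> [e1 /= e10 He1].
(* [e <= s] gives rho = s/e >= 1 for [tent_test]; [e < e1] puts the bump where [v] exceeds [eta]. *)
pose e := Num.min s (e1 / 2).
have e0 : 0 < e by rewrite lt_min s0 divr_gt0.
have es : e <= s by rewrite ge_min lexx.
have ee1 : e < e1.
  by apply: (@le_lt_trans _ _ (e1 / 2)); [rewrite ge_min lexx orbT|lra].
have [|P [_ _ Ptest]] := @tent_test R (s / e); first by rewrite ler_pdivlMr// mul1r.
have [tpsi psi2] := Ptest e e0; have := Hu _ tpsi.
set psi := (fun x => P (e^-1 * x)) in tpsi psi2 *.
pose F (x : R) := v x * (e ^- 2 * bump (e^-1 * x - s / e)).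
have [beta beta0 Hbeta] := @bump_lower_bound R.
have FE : \int[mu]_x F x = u s * \int[mu]_x (u x * derive1n 2 psi x).
  rewrite -RintegralZl//; last exact: integrable_mul_test.
  apply: eq_Rintegral => x _; rewrite /F /v; have [x_le0|x_gt0] := leP x 0.
    rewrite (u0 _ x_le0). by rewrite mulr0 !mul0r mulr0.
  by rewrite psi2// mulrA.
have dist x : `|e^-1 * x - s / e| = `|x - s| / e.
  by rewrite mulrC -mulrBl normrM [X in _ * X]gtr0_norm ?invr_gt0.
have Fint : 0 < \int[mu]_x F x.
  apply: (@lt_le_trans _ _
    ((eta * (e ^- 2 * beta)) * ((s + 2^-1 * e) - (s - 2^-1 * e)))).
    apply: mulr_gt0; last lra.
    by apply: mulr_gt0 => //; apply: mulr_gt0 => //; rewrite invr_gt0 exprn_gt0.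
  have ei : 0 <= e ^- 2 by rewrite invr_ge0 exprn_ge0// ltW.
  apply: Rintegral_ge_cst; first lra.
  - apply: (@integrable_cpt _ _ (s + e)).
      move=> x; apply: cvgM; first exact: cv.
      by apply: cvgM; [exact: cvg_cst|exact: continuous_bump_affine].
    move=> x sx; rewrite /F bump_eq0 ?mulr0//.
    have : 1 <= `|e^-1 * x - s / e|.
      rewrite dist ler_pdivlMr// mul1r.
      have : `|x| <= `|x - s| + `|s| by rewrite -{1}(subrK s x) ler_normD.
      rewrite (gtr0_norm s0); lra.
    by rewrite ler_normr => /orP[|] h; [right|left]; lra.
  - move=> x; have [xe|xe] := leP e `|x - s|.
      rewrite /F bump_eq0 ?mulr0//.
      have : 1 <= `|e^-1 * x - s / e| by rewrite dist ler_pdivlMr// mul1r.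
      by rewrite ler_normr => /orP[|] h; [right|left]; lra.
    apply: mulr_ge0; last by rewrite mulr_ge0// bump_ge0.
    apply/ltW/(lt_trans eta0)/He1; rewrite /= distrC; lra.
  - move=> x xs.
    have xse : `|x - s| <= 2^-1 * e by rewrite ler_norml; lra.
    apply: ler_pM; [lra|by rewrite mulr_ge0// ltW| |].
      by apply/ltW/He1; rewrite /= distrC; lra.
    rewrite ler_wpM2l//; apply: Hbeta.
    by rewrite dist ler_pdivrMr.
by move=> H0; move: Fint; rewrite FE H0 mulr0 ltxx.
Qed.

(** [f] may blow up at [a]. Integrability still makes the indefinite integral [J] continuous on the
    closed interval, and [J - F] has zero derivative inside, hence is constant. *)
Lemma FTC_right_singular F f (a b : R) : a < b ->
  (forall x : R, a < x -> is_derive x 1 F (f x)) ->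
  (forall x : R, a < x -> {for x, continuous f}) ->
  F x @[x --> a^'+] --> F a -> mu.-integrable `[a, b] (EFin \o f) ->
  \int[mu]_(x in `[a, b]) f x = F b - F a.
Proof.
move=> ab dF cf Fa fi.
pose J (x : R) := \int[mu]_(t in `[a, x]) f t.
have cJ : {within `[a, b], continuous J}.
  exact: (parameterized_integral_continuous (ltW ab) fi).
have cFx x : a < x -> {for x, continuous F}.
  move=> ax; apply: differentiable_continuous; apply/derivable1_diffP.
  by have [] := dF x ax.
have cF : {within `[a, b], continuous F}.
  apply/(continuous_within_itvP _ ab); split => //.
  - by move=> x; rewrite in_itv/= => /andP[ax _]; exact: cFx.
  - by apply: cvg_at_left_filter; exact: cFx.
have dJ x : x \in `]a, b[ -> is_derive x 1 (fun y => J y - F y) 0.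
  rewrite in_itv/= => /andP[ax xb].
  have [dJ J'] := continuous_FTC1_closed xb fi ax (cf x ax).
  have dJx : is_derive x 1 J (f x) by split => //; rewrite -derive1E.
  by apply: (is_derive_eq (is_deriveB dJx (dF x ax))); rewrite subrr.
have [|c _] := MVT_segment (ltW ab) dJ.
  move=> x; apply: continuousB; [exact: cJ|exact: cF].
rewrite mul0r /J set_itv1 Rintegral_set1; lra.
Qed.

(** Monotone convergence along compact subintervals: each integral is a difference of values of the
    nonnegative primitive [F], hence at most F(L). *)
Lemma powR_integrable (gamma L : R) : 0 < gamma -> 0 < L ->
  mu.-integrable `]0, L] (EFin \o (fun x => x `^ (gamma - 1))).
Proof.
move=> gamma0 L0.
pose f (x : R) := x `^ (gamma - 1).
pose F (x : R) := gamma^-1 * x `^ gamma.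
have cf (x : R) : 0 < x -> {for x, continuous f}.
  move=> x0; apply: differentiable_continuous; apply/derivable1_diffP.
  by have [] := @is_derive1_powR R (gamma - 1) x x0.
have dF (x : R) : 0 < x -> is_derive x 1 F (f x).
  move=> x0; apply: (is_derive_eq (is_deriveZ gamma^-1 (is_derive1_powR gamma x0))).
  by rewrite /GRing.scale/= mulrA mulVf ?mul1r// gt_eqF.
have mf : measurable_fun (`]0, L]%classic : set (measurableTypeR R)) f.
  apply: (@measurable_funS _ _ _ _
    (`]0, +oo[%classic : set (measurableTypeR R))) => //.
    by move=> x; rewrite /= !in_itv/= => /andP[->].
  apply: open_continuous_measurable_fun => //.
  by move=> x; rewrite inE/= in_itv/= andbT; exact: cf.
apply/integrableP; split; first exact/measurable_EFinP.
rewrite (eq_integral (fun x : measurableTypeR R => (f x)%:E)); last first.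
  by move=> x _ /=; rewrite ger0_norm// powR_ge0.
pose E (i : nat) : set (measurableTypeR R) := `[(L / i.+1%:R)%R, L]%classic.
have EU : `]0%R, L]%classic = \bigcup_i E i.
  apply/seteqP; split => x /=; rewrite in_itv/=.
    move=> /andP[x0 xL].
    exists (Num.truncn (L / x)) => //; rewrite /E/= in_itv/= xL andbT.
    rewrite ler_pdivrMr ?ltr0n// -ler_pdivrMl// mulrC.
    by apply/ltW/truncnS_gt.
  move=> [i _]; rewrite /E/= in_itv/= => /andP[ix ->]; rewrite andbT.
  by apply: lt_le_trans ix; rewrite divr_gt0// ltr0n.
rewrite EU.
have cvg : (\int[mu]_(x in E i) (f x)%:E)%E @[i --> \oo] -->
    (\int[mu]_(x in \bigcup_i E i) (f x)%:E)%E.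
  apply: ge0_nondecreasing_set_cvg_integral.
  - apply/nondecreasing_seqP => n; rewrite subsetEset /E => x /=.
    rewrite !in_itv/= => /andP[nx ->]; rewrite andbT; apply: le_trans nx.
    by rewrite ler_pM2l// lef_pV2 ?posrE ?ltr0n// ler_nat.
  - by move=> i; exact: measurable_itv.
  - move=> i; apply/measurable_EFinP; apply: measurable_funS mf => //.
    by rewrite EU; exact: bigcup_sup.
  - by move=> i x _; rewrite lee_fin powR_ge0.
apply: (@le_lt_trans _ _ (F L)%:E); last exact: ltry.
apply: (cvge_le _ cvg).
near=> i.
(* At i = 0 the interval degenerates to the point [L]; the fundamental theorem is applied to genuine
   intervals only. *)
have i0 : 0 < i%:R :> R by rewrite ltr0n; near: i; exact: nbhs_infty_gt.
have a0 : 0 < L / i.+1%:R by rewrite divr_gt0// ltr0n.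
have aL : L / i.+1%:R < L.
  by rewrite ltr_pdivrMr ?ltr0n// ltr_pMr// -[1]/(1%:R) ltr_nat ltnS -(ltr0n R).
have xa x : x \in `](L / i.+1%:R), L[ -> 0 < x.
  by rewrite in_itv/= => /andP[h _]; exact: lt_trans h.
rewrite (@continuous_FTC2 _ f F)//.
- rewrite -EFinB lee_fin gerBl /F mulr_ge0 ?invr_ge0 ?powR_ge0//; exact: ltW.
- apply: continuous_in_subspaceT => x; rewrite inE/= in_itv/= => /andP[h _].
  by apply: cf; exact: lt_le_trans h.
- have cF (x : R) : 0 < x -> {for x, continuous F}.
    move=> x0; apply: differentiable_continuous; apply/derivable1_diffP.
    by have [] := dF x x0.
  split.
  + by move=> x /xa x0; have [] := dF x x0.
  + exact/cvg_at_right_filter/cF.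
  + exact/cvg_at_left_filter/cF.
- by move=> x /xa x0; rewrite derive1E; have [] := dF x x0.
Unshelve. all: by end_near. Qed.

(** Since [u] never leaves the half-line, one-sided continuity of [f] at 0 is enough. *)
Lemma continuous_comp_halfline f u : {within `[0, +oo[, continuous f} ->
  continuous u -> (forall t, 0 <= u t) -> continuous (f \o u).
Proof.
move=> cf cu u0 t.
have /subspace_continuousP/(_ (u t)) := cf.
rewrite /= in_itv/= andbT => /(_ (u0 t)) cft.
apply/cvgrPdist_le => e e0.
have /cvgrPdist_le/(_ e e0) := cft.
rewrite near_withinE => H.
apply: (@filterS _ (nbhs t) _ _ _ _ (cu t _ H)) => x /=; apply.
by rewrite in_itv/= u0.
Qed.

Lemma continuous_powR_ge1 u (m : R) : 1 <= m -> continuous u ->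
  (forall t, 0 <= u t) -> continuous (fun t => u t `^ m).
Proof.
move=> m1 cu u0.
suff cp : {within `[0, +oo[, continuous (fun x : R => x `^ m)}.
  exact: (continuous_comp_halfline cp cu u0).
apply/continuous_within_itvcyP; split.
  move=> x; rewrite in_itv/= andbT => x0.
  apply: differentiable_continuous; apply/derivable1_diffP.
  by have [] := @is_derive1_powR R m x x0.
rewrite powR0; last by rewrite gt_eqF//; lra.
by apply: powR_cvg0; lra.
Qed.

End tools.

(** * The case [m < 2] *)

Section profile.
Context {R : realType}.
Local Notation mu := (@lebesgue_measure R).

(** The equation says that D phi^m and the second primitive of c phi' + h have the same second
    distributional derivative. Both vanish on the left half-line, so no affine term separates
    them. *)
Lemma wave_profile_derive (m D r c : R) (b d phi : R -> R) :
  1 < m -> 0 <= r -> 0 < c ->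
  {within `[0, +oo[, continuous d} -> d 0 = 0 ->
  {within `[0, +oo[, continuous b} -> b 0 = 0 ->
  continuous phi -> (forall t, 0 <= phi t) -> (forall t, t <= 0 -> phi t = 0) ->
  wave_eq m D r c b d phi ->
  let h t := d (phi t) - b (phi (t - c * r)) in
  continuous h /\
  exists H, [/\ forall x : R, is_derive x 1 H (h x),
    forall x, x <= 0 -> H x = 0 &
    forall x : R, is_derive x 1 (fun y => D * phi y `^ m) (c * phi x + H x)].
Proof.
move=> m1 r0 c0 cd d0 cb b0 cphi phi_ge0 phi0 weq h.
pose phir t := phi (t - c * r).
have cr0 : 0 <= c * r by rewrite mulr_ge0// ltW.
have cphir : continuous phir.
  move=> t; apply: (@cvg_comp _ _ _ (fun y => y - c * r) phi); last exact: cphi.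
  by apply: cvgB; [exact: cvg_id|exact: cvg_cst].
have cdp : continuous (fun t => d (phi t)).
  exact: (continuous_comp_halfline cd cphi phi_ge0).
have cbp : continuous (fun t => b (phir t)).
  exact: (continuous_comp_halfline cb cphir (fun t => phi_ge0 _)).
have ch : continuous h by move=> t; apply: cvgB; [exact: cdp|exact: cbp].
split=> //.
(* The delay [c * r] is nonnegative, so the delayed argument is also nonpositive. *)
have h0 x : x <= 0 -> h x = 0.
  by move=> x0; rewrite /h !phi0 ?d0 ?b0 ?subrr//; lra.
have [H dH H0] := antiderivative_left ch h0.
exists H; split => //.
pose G x := c * phi x + H x.
have cH := is_derive_continuous dH.
have cG : continuous G.
  move=> x; apply: cvgD; last exact: cH.
  by apply: cvgM; [exact: cvg_cst|exact: cphi].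
have G0 x : x <= 0 -> G x = 0 by move=> x0; rewrite /G phi0// H0// mulr0 addr0.
have [V dV V0] := antiderivative_left cG G0.
have cV := is_derive_continuous dV.
pose u x := D * phi x `^ m - V x.
have cpm : continuous (fun x => phi x `^ m).
  by apply: continuous_powR_ge1 => //; exact: ltW.
have cu : continuous u.
  move=> x; apply: cvgB; last exact: cV.
  by apply: cvgM; [exact: cvg_cst|exact: cpm].
have uE : forall t, u t = 0.
  apply: weak_affine_eq0 => //.
    move=> t t0; rewrite /u phi0// V0// powR0 ?mulr0 ?subr0// gt_eqF//; lra.
  move=> psi tpsi; have := weq psi tpsi.
  have -> : \int[mu]_x (u x * derive1n 2 psi x) =
      D * \int[mu]_x (phi x `^ m * derive1n 2 psi x)
      - \int[mu]_x (V x * derive1n 2 psi x).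
    rewrite -RintegralZl//; last exact: integrable_mul_test.
    rewrite -RintegralB//; last 2 first.
    - under [fun x => D * _]eq_fun do rewrite mulrA.
      apply: (@integrable_mul_test _ (fun x => D * phi x `^ m)) => //.
      by move=> x; apply: cvgM; [exact: cvg_cst|exact: cpm].
    - exact: integrable_mul_test.
    by apply: eq_Rintegral => x _; rewrite /u mulrBl mulrA.
  (* One integration by parts turns V psi'' into G psi', and a second one, on the [H] part only,
     reaches the reaction term; the [phi] part is the left side of the wave equation. *)
  rewrite (integration_by_parts_test 1 dV cG tpsi).
  have -> : \int[mu]_x (G x * derive1n 1 psi x) =
      c * \int[mu]_x (phi x * derive1n 1 psi x) +
      \int[mu]_x (H x * derive1n 1 psi x).
    rewrite -RintegralZl//; last exact: integrable_mul_test.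
    rewrite -RintegralD//; last 2 first.
    - under [fun x => c * _]eq_fun do rewrite mulrA.
      apply: (@integrable_mul_test _ (fun x => c * phi x)) => //.
      by move=> x; apply: cvgM; [exact: cvg_cst|exact: cphi].
    - exact: integrable_mul_test.
    by apply: eq_Rintegral => x _; rewrite /G mulrDl mulrA.
  rewrite (integration_by_parts_test 0 dH ch tpsi).
  have -> : \int[mu]_x (h x * derive1n 0 psi x) =
      \int[mu]_x (d (phi x) * psi x) - \int[mu]_x (b (phi (x - c * r)) * psi x).
    rewrite -RintegralB//; last 2 first.
    - exact: (@integrable_mul_test _ (fun x => d (phi x)) psi 0).
    - exact: (@integrable_mul_test _ (fun x => b (phir x)) psi 0).
    by apply: eq_Rintegral => x _; rewrite /h mulrBl.
  rewrite derive1n1; lra.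
move=> x; have -> : (fun y => D * phi y `^ m) = V.
  by apply/funext => y; have := uE y; rewrite /u => /eqP; rewrite subr_eq0 => /eqP.
exact: dV.
Qed.

(* The bounds below are homogeneous in [t]: with [p = t^(alpha-1)] one has [phi ~ t p] and [q = phi^(1-m) <= 1 / (a1 t)]. *)
Lemma profile_bounds (c D m A Kh KG a1 t p ph G h q phi1 : R) :
  0 < c -> 0 < D -> 1 < m -> 0 < A -> 0 <= Kh -> 0 <= KG -> 0 < a1 ->
  0 < t -> t <= 1 -> 0 < p -> 0 <= q ->
  A * (t * p) <= ph -> `|G| <= KG * (t * p) -> `|h| <= Kh * (t * p) ->
  q <= (a1 * t)^-1 -> phi1 = (D * m)^-1 * (G * q) ->
  `|phi1| <= KG / (D * m * a1) * p /\
  `|(D * m)^-1 * (G * ((1 - m) * (q / ph) * phi1) + q * (c * phi1 + h))| <=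
  (D * m)^-1 * (KG * ((m - 1) * (KG / (D * m * a1)) / (a1 * A)) +
    a1^-1 * (c * (KG / (D * m * a1)) + Kh)) * (p / t).
Proof.
move=> c0 D0 m1 A0 Kh0 KG0 a10 t0 t1 p0 q0 phA GK hK qa phi1E.
have m0 : 0 < m by lra.
have Dm0 : 0 < D * m by rewrite mulr_gt0.
have ph0 : 0 < ph by apply: lt_le_trans phA; rewrite !mulr_gt0.
set K1 := KG / (D * m * a1).
have K10 : 0 <= K1 by rewrite divr_ge0// ltW// mulr_gt0.
have phi1K : `|phi1| <= K1 * p.
  rewrite phi1E normrM (gtr0_norm (x := (D * m)^-1)) ?invr_gt0// normrM (ger0_norm q0).
  have -> : K1 * p = (D * m)^-1 * (KG * (t * p) * (a1 * t)^-1).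
    by rewrite /K1; field; rewrite !gt_eqF.
  rewrite ler_pM2l ?invr_gt0//; exact: ler_pM.
split=> //.
rewrite normrM (gtr0_norm (x := (D * m)^-1)) ?invr_gt0// -[leRHS]mulrA.
rewrite ler_pM2l ?invr_gt0// [leRHS]mulrDl.
apply: (le_trans (ler_normD _ _)); apply: lerD.
- rewrite !normrM (ltr0_norm (x := 1 - m)); last lra.
  have -> : KG * ((m - 1) * K1 / (a1 * A)) * (p / t) =
     (KG * (t * p)) * ((- (1 - m)) * ((a1 * t)^-1 * (A * (t * p))^-1) * (K1 * p)).
    by field; rewrite !gt_eqF.
  have m1' : 0 <= - (1 - m) by rewrite oppr_ge0; lra.
  rewrite (ger0_norm q0) normfV (gtr0_norm ph0).
  have qph : 0 <= q / ph by rewrite divr_ge0// ltW.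
  apply: ler_pM => //; first by apply: mulr_ge0 => //; exact: mulr_ge0.
  apply: ler_pM => //; first exact: mulr_ge0.
  rewrite ler_wpM2l//; apply: ler_pM => //; first by rewrite invr_ge0 ltW.
  by rewrite lef_pV2// posrE !mulr_gt0.
- rewrite normrM (ger0_norm q0).
  have -> : a1^-1 * (c * K1 + Kh) * (p / t) = (a1 * t)^-1 * (c * (K1 * p) + Kh * p).
    by field; rewrite !gt_eqF.
  apply: ler_pM => //.
  apply: (le_trans (ler_normD _ _)); apply: lerD.
    by rewrite normrM (gtr0_norm c0) ler_pM2l.
  (* The reaction term has a spare factor t <= 1, dropped to match the order of phi'. *)
  apply: (le_trans hK); rewrite ler_wpM2l// ler_piMl// ltW//.
Qed.

End profile.

(** * Local integrability of the second derivative at the edge of the support *)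

Section C1.
Context {R : realType}.
Local Notation mu := (@lebesgue_measure R).

(** The error is C2 t^(Lambda - alpha) times t^alpha. Its first factor tends to 0, so near 0 it is
    below C1/2, and below C2 because t <= 1. *)
Lemma power_expansion_bounds (phi : R -> R) (alpha Lambda C1 C2 : R) :
  alpha < Lambda -> 0 < C1 -> 0 < C2 ->
  (forall t, 0 < t < 1 -> `|phi t - C1 * t `^ alpha| <= C2 * t `^ Lambda) ->
  exists t0, 0 < t0 <= 1 /\ forall t, 0 < t < t0 ->
    C1 / 2 * t `^ alpha <= phi t <= (C1 + C2) * t `^ alpha.
Proof.
move=> aL C10 C20 Hphi.
have e0 : 0 < C1 / 2 / C2 by rewrite !divr_gt0.
have La : 0 < Lambda - alpha by rewrite subr_gt0.
have [d /= d0 Hd] : \forall t \near (0:R)^'+, t `^ (Lambda - alpha) < C1 / 2 / C2.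
  by have := powR_cvg0 La => /cvgr_lt; apply.
exists (Num.min d 1); split; first by rewrite lt_min d0 ltr01 ge_min lexx orbT.
move=> t /andP[t0]; rewrite lt_min => /andP[td t1].
have /ltW tle : t `^ (Lambda - alpha) < C1 / 2 / C2.
  by apply: Hd => //=; rewrite sub0r normrN gtr0_norm.
have tE : t `^ Lambda = t `^ (Lambda - alpha) * t `^ alpha.
  by rewrite -powRD ?subrK//; apply/implyP => _; rewrite gt_eqF.
have p0 : 0 <= t `^ alpha by exact: powR_ge0.
have t_le1 : t `^ (Lambda - alpha) <= 1.
  rewrite -(powRr0 t) ger_powR ?(ltW La)//; by rewrite t0 ltW.
have := Hphi t; rewrite t0 t1 => /(_ isT).
rewrite ler_distl tE => /andP[lo hi].
have h1 : C2 * (t `^ (Lambda - alpha) * t `^ alpha) <= C1 / 2 * t `^ alpha.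
  rewrite mulrA ler_wpM2r//.
  by move: tle; rewrite ler_pdivlMr// mulrC.
have h2 : C2 * (t `^ (Lambda - alpha) * t `^ alpha) <= C2 * t `^ alpha.
  by rewrite ler_pM2l// ler_piMl.
apply/andP; split; lra.
Qed.

Lemma is_derive_for_continuous (f : R -> R) (x y : R) :
  is_derive x 1 f y -> {for x, continuous f}.
Proof.
by move=> [dx _]; apply: differentiable_continuous; apply/derivable1_diffP.
Qed.

Lemma is_derive_powR_comp (f : R -> R) (a x y : R) : 0 < f x ->
  is_derive x 1 f y ->
  is_derive x 1 (fun t => f t `^ a) (a * f x `^ (a - 1) * y).
Proof.
move=> fx df.
have dp : is_derive (f x) 1 (fun t => t `^ a) (a * f x `^ (a - 1)).
  exact: is_derive1_powR.
exact: (is_derive1_comp dp df).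
Qed.

(** The classical second derivative on the open right half-line, extended by 0, is the candidate
    density; it remains to integrate it at 0 and to exclude a boundary contribution there. *)
Lemma profile_second_deriv_L1loc (m D c A B Kh t0 : R) (phi h H : R -> R) :
  1 < m -> m < 2 -> 0 < D -> 0 < c -> 0 < A -> 0 <= B -> 0 <= Kh -> 0 < t0 <= 1 ->
  continuous phi -> (forall t, t <= 0 -> phi t = 0) ->
  (forall t, 0 < t -> 0 < phi t) ->
  continuous h -> (forall x : R, is_derive x 1 H (h x)) ->
  (forall x, x <= 0 -> H x = 0) ->
  (forall x : R, is_derive x 1 (fun y => D * phi y `^ m) (c * phi x + H x)) ->
  (forall t, 0 < t < t0 ->
    A * t `^ (1 / (m - 1)) <= phi t <= B * t `^ (1 / (m - 1))) ->
  (forall t, 0 < t < t0 -> `|h t| <= Kh * t `^ (1 / (m - 1))) ->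
  second_deriv_L1loc phi.
Proof.
move=> m1 m2 D0 c0 A0 B0 Kh0 /andP[t00 t01] cphi phi0 phi_gt0 ch dH H0 dW bphi bh.
set alpha := 1 / (m - 1) in bphi bh.
have m0 : 0 < m by lra.
have Dm0 : 0 < D * m by rewrite mulr_gt0.
have m10 : 0 < m - 1 by lra.
(* This is where m < 2 enters. *)
have alpha1 : 0 < alpha - 1 by rewrite subr_gt0 ltr_pdivlMr// mul1r; lra.
have phi_ge0 t : 0 <= phi t.
  by have [/phi0 ->//|/phi_gt0/ltW] := leP t 0.
pose G x := c * phi x + H x.
(* Solving D m phi^(m-1) phi' = G for phi' gives [phi1]; one more differentiation gives [g]. *)
pose phi1 x := if 0 < x then (D * m)^-1 * (G x * phi x `^ (1 - m)) else 0.
pose g x := if 0 < x then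
  (D * m)^-1 * (G x * ((1 - m) * phi x `^ (1 - m - 1) * phi1 x) +
                phi x `^ (1 - m) * (c * phi1 x + h x)) else 0.
have dphi (x : R) : 0 < x -> is_derive x 1 phi (phi1 x).
  move=> x0; rewrite /phi1 x0.
  have dW' : is_derive x 1 (fun y => phi y `^ m) (D^-1 * G x).
    have := is_deriveZ D^-1 (dW x).
    rewrite (_ : D^-1 \*: _ = (fun y => phi y `^ m))//.
    by apply/funext => y /=; rewrite /GRing.scale/= mulrA mulVf ?mul1r// gt_eqF.
  (* Only phi^m is known to be differentiable; taking the m-th root, smooth where phi > 0, transfers
     this to [phi]. *)
  have phiE : phi = (fun y => (phi y `^ m) `^ m^-1).
    by apply/funext => y; rewrite -powRrM mulfV ?powRr1// gt_eqF.
  rewrite [X in is_derive _ _ X _]phiE.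
  have W0 : 0 < phi x `^ m by rewrite powR_gt0// phi_gt0.
  apply: (is_derive_eq
    (@is_derive_powR_comp (fun y => phi y `^ m) m^-1 x _ W0 dW')).
  rewrite -powRrM (_ : m * (m^-1 - 1) = 1 - m).
    by rewrite invfM; ring.
  by rewrite mulrBr mulfV ?mulr1// gt_eqF.
have dG (x : R) : 0 < x -> is_derive x 1 G (c * phi1 x + h x).
  move=> x0; have dp := dphi x x0.
  by apply: (is_derive_eq (is_deriveD (is_deriveZ c dp) (dH x))).
have dphi1 (x : R) : 0 < x -> is_derive x 1 phi1 (g x).
  move=> x0; have dp := dphi x x0; have dGx := dG x x0.
  apply: (@near_eq_is_derive _ _ _
      (fun y => (D * m)^-1 * (G y * phi y `^ (1 - m)))).
    have : \forall y \near x, 0 < y by exact: lt_nbhsr.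
    by apply: filterS => y y0; rewrite /phi1 y0.
  have dq := is_derive_powR_comp (1 - m) (phi_gt0 x x0) dp.
  apply: (is_derive_eq (is_deriveZ (D * m)^-1 (is_deriveM dGx dq))).
  by rewrite /g x0 /GRing.scale/=.
have cgx (x : R) : 0 < x -> {for x, continuous g}.
  move=> x0.
  have cp1 := is_derive_for_continuous (dphi1 x x0).
  have cG := is_derive_for_continuous (dG x x0).
  have cpow (a : R) : {for x, continuous (fun y => phi y `^ a)}.
    exact: (is_derive_for_continuous (is_derive_powR_comp a (phi_gt0 x x0) (dphi x x0))).
  pose gg y := (D * m)^-1 * (G y * ((1 - m) * phi y `^ (1 - m - 1) * phi1 y) +
                phi y `^ (1 - m) * (c * phi1 y + h y)).
  have ggx : gg y @[y --> x] --> gg x.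
    apply: cvgM; first exact: cvg_cst.
    apply: cvgD; apply: cvgM; [exact: cG| |exact: cpow|].
      apply: cvgM; last exact: cp1.
      by apply: cvgM; [exact: cvg_cst|exact: cpow].
    apply: cvgD; last exact: ch.
    by apply: cvgM; [exact: cvg_cst|exact: cp1].
  have -> : {for x, continuous g} = (g y @[y --> x] --> gg x).
    by rewrite /prop_for /continuous_at {2}/g x0.
  apply: cvg_trans ggx; apply: near_eq_cvg.
  have : \forall y \near x, 0 < y by exact: lt_nbhsr.
  by apply: filterS => y y0; rewrite /g y0.
(* [c * B] bounds c phi and [Kh] bounds H: the mean value theorem gives H(t) = t h(x) with 0 < x < t
   <= 1. *)
pose KG := c * B + Kh.
have KG0 : 0 <= KG by rewrite addr_ge0// mulr_ge0// ltW.
have bG t : 0 < t < t0 -> `|G t| <= KG * t `^ alpha.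
  move=> /andP[tp tt0].
  have tt : 0 < t < t0 by rewrite tp.
  have [x xt] := @MVT R H h 0 t tp (fun x _ => dH x)
    (continuous_subspaceT (is_derive_continuous dH)).
  rewrite (H0 0)// !subr0 => Ht.
  move: xt; rewrite in_itv/= => /andP[x0 xt].
  have hx : `|h x| <= Kh * t `^ alpha.
    apply: (le_trans (bh x _)); first by rewrite x0 (lt_trans xt).
    rewrite ler_wpM2l// ge0_ler_powR ?nnegrE ?ltW//.
    lra.
  rewrite /G /KG mulrDl; apply: (le_trans (ler_normD _ _)); apply: lerD.
    rewrite normrM (gtr0_norm c0) ger0_norm// -mulrA ler_pM2l//.
    by have /andP[] := bphi t tt.
  rewrite Ht normrM (gtr0_norm tp).
  apply: le_trans hx; rewrite ler_piMr//; lra.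
(* As alpha (m - 1) = 1, the lower bound on [phi] yields phi^(m-1) >= a1 t. *)
pose a1 := A `^ (m - 1).
have a10 : 0 < a1 by rewrite powR_gt0.
pose K1 := KG / (D * m * a1).
pose K2 := (D * m)^-1 * (KG * ((m - 1) * K1 / (a1 * A)) + a1^-1 * (c * K1 + Kh)).
have bounds t : 0 < t < t0 ->
    `|phi1 t| <= K1 * t `^ (alpha - 1) /\ `|g t| <= K2 * t `^ (alpha - 1 - 1).
  move=> tt; have /andP[tp tt0] := tt.
  have tpE : t * t `^ (alpha - 1) = t `^ alpha.
    by rewrite mulr_powRB1// ?ltW//; lra.
  have tpE2 : t `^ (alpha - 1) / t = t `^ (alpha - 1 - 1).
    by rewrite [RHS]powRB ?(gt_eqF tp) ?implybT// powRr1// ltW.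
  have qE : phi t `^ (1 - m - 1) = phi t `^ (1 - m) / phi t.
    by rewrite [LHS]powRB ?(gt_eqF (phi_gt0 t tp)) ?implybT// powRr1.
  rewrite -tpE2 /g tp qE.
  apply: (@profile_bounds R c D m A Kh KG a1 t) => //.
  - lra.
  - exact: powR_gt0.
  - exact: powR_ge0.
  - by rewrite tpE; have /andP[] := bphi t tt.
  - by rewrite tpE; exact: bG.
  - by rewrite tpE; exact: bh.
  - have -> : 1 - m = - (m - 1) by ring.
    rewrite powRN lef_pV2 ?posrE ?powR_gt0 ?mulr_gt0 ?phi_gt0//.
    have -> : a1 * t = (A * t `^ alpha) `^ (m - 1).
      rewrite powRM ?powR_ge0 ?(ltW A0)// -powRrM /alpha mul1r mulVf ?powRr1 ?ltW//.
      by rewrite gt_eqF.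
    rewrite ge0_ler_powR ?nnegrE// ?(ltW m10)// ?mulr_ge0 ?powR_ge0 ?(ltW A0)//.
    by have /andP[] := bphi t tt.
  - by rewrite /phi1 tp.
have mg : measurable_fun (`]0, +oo[%classic : set (measurableTypeR R)) g.
  apply: open_continuous_measurable_fun => //.
  by move=> x; rewrite inE/= in_itv/= andbT; exact: cgx.
have gint (L : R) : 0 < L -> mu.-integrable `]0, L] (EFin \o g).
  move=> L0; pose d := t0 / 2.
  have d0 : 0 < d by rewrite divr_gt0.
  have [M HM] : exists M, forall x, d <= x <= L -> `|g x| <= M.
    have [dL|Ld] := leP d L; last by exists 0 => x; lra.
    have [|x _ xM] := @EVT_max R (fun x => `|g x|) d L dL.
      apply: continuous_in_subspaceT => x; rewrite inE/= in_itv/= => /andP[dx _].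
      by apply: cvg_norm; apply: cgx; exact: lt_le_trans dx.
    by exists `|g x| => y yP; apply: xM; rewrite in_itv.
  (* The power dominates [g] before t0/2 and the constant dominates it after; the exponent alpha - 2
     exceeds -1. *)
  have ip : mu.-integrable `]0, L]
      (EFin \o (fun x => K2 * x `^ (alpha - 1 - 1) + `|M|)).
    have mI : measurable (`]0%R, L]%classic : set (measurableTypeR R)) by [].
    have j1 := integrableZl mI K2 (powR_integrable alpha1 L0).
    have j2 : mu.-integrable `]0, L] (EFin \o cst `|M|).
      apply: (@integrableS _ _ _ mu `[0, L]) => //.
        by apply: subset_itvr; rewrite bnd_simp.
      by apply: continuous_integrable_itv => x; exact: cvg_cst.
    exact: (integrableD mI j1 j2).
  apply: le_integrable ip => //.
    apply/measurable_EFinP; apply: measurable_funS mg => //.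
    by move=> x; rewrite /= !in_itv/= => /andP[->].
  move=> x; rewrite /= in_itv/= lee_fin => /andP[x0 xL].
  apply: le_trans (ler_norm _).
  have [xd|dx] := ltP x d.
    have xt : 0 < x < t0 by rewrite x0/=; rewrite /d in xd; lra.
    by have [_ h2] := bounds x xt; apply: (le_trans h2); rewrite lerDl.
  apply: (@le_trans _ _ `|M|).
    by apply: (le_trans (HM x _)); [rewrite dx|exact: ler_norm].
  (* The sign of [K2] is read off from its bound on |g| at t0/2. *)
  rewrite lerDr mulr_ge0 ?powR_ge0//.
  have := bounds (t0 / 2) _; rewrite divr_gt0//= => /(_ _)[|_ h2]; first lra.
  have := le_trans (normr_ge0 _) h2.
  by rewrite pmulr_lge0// powR_gt0// divr_gt0.
have gcc (a b : R) : mu.-integrable `[a, b] (EFin \o g).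
  pose L := `|b| + 1.
  have L0 : 0 < L by rewrite ltr_wpDl.
  have bL : b <= L by apply: (le_trans (ler_norm b)); rewrite lerDl.
  have gT : mu.-integrable `]-oo, L] (EFin \o g).
    apply: (@integrable_supp _ g `]0, L]) => //; last exact: gint.
      by move=> x; rewrite /= !in_itv/= => /andP[].
    move=> x; rewrite /= !in_itv/= => xL /negP; rewrite xL andbT => x0.
    by rewrite /g (negbTE x0).
  apply: integrableS gT => // x; rewrite /= !in_itv/= => /andP[_ xb].
  exact: le_trans bL.
exists g; split => // psi tpsi.
have [K HK] := test_fun_supp tpsi.
have HK0 x : K < `|x| -> psi x = 0 by exact: (HK 0).
pose L := `|K| + 1.
have L0 : 0 < L by rewrite ltr_wpDl.
have KL : K < L by rewrite (le_lt_trans (ler_norm _))// ltrDl.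
have off x : 0 < x -> ~ ((x \in `[0, L]) : Prop) -> K < `|x|.
  move=> x0 /negP; rewrite in_itv/= (ltW x0)/= -ltNge => Lx.
  by rewrite gtr0_norm// (lt_trans KL).
rewrite (@Rintegral_supp _ _ `[0, L])//; last first.
  move=> x _ xL; have [x0|x0] := leP x 0; first by rewrite phi0// mul0r.
  by rewrite HK ?mulr0//; exact: off.
rewrite [RHS](@Rintegral_supp _ _ `[0, L])//; last first.
  move=> x _ xL; have [x0|x0] := leP x 0; first by rewrite /g ltNge x0 mul0r.
  by rewrite HK0 ?mulr0//; exact: off.
have i1 : mu.-integrable `[0, L] (EFin \o (fun x => phi x * derive1n 2 psi x)).
  apply: continuous_integrable_itv => x.
  by apply: cvgM; [exact: cphi|exact: test_fun_continuous].
have i2 : mu.-integrable `[0, L] (EFin \o (fun x => g x * psi x)).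
  by apply: loc_int_mul_continuous; [exact: gcc|exact: (@test_fun_continuous _ psi 0)].
apply/eqP; rewrite -subr_eq0 -RintegralB//; apply/eqP.
(* F' = phi psi'' - g psi for x > 0, so the two sides differ by F(L) - F(0), and both values
   vanish. *)
pose F x := phi x * derive1n 1 psi x - phi1 x * psi x.
have FL : F L = 0.
  by rewrite /F HK ?HK0 ?mulr0 ?subrr// gtr0_norm.
have F0 : F 0 = 0 by rewrite /F phi0// /phi1 ltxx !mul0r subrr.
have -> : \int[mu]_(x in `[0, L]) (phi x * derive1n 2 psi x - g x * psi x) =
    F L - F 0.
  apply: FTC_right_singular => //.
  - move=> x x0.
    have d1 := is_deriveM (dphi x x0) (test_fun_derive 1 x tpsi).
    have d2 := is_deriveM (dphi1 x x0) (test_fun_derive 0 x tpsi).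
    apply: (is_derive_eq (is_deriveB d1 d2)).
    by rewrite /GRing.scale/=; ring.
  - move=> x x0; apply: cvgB; apply: cvgM.
    + exact: cphi.
    + exact: test_fun_continuous.
    + exact: cgx.
    + exact: (@test_fun_continuous _ psi 0).
  - rewrite F0 -[X in _ --> X](subrr 0).
    have cpsi1 : derive1n 1 psi x @[x --> 0^'+] --> derive1n 1 psi 0.
      exact/cvg_at_right_filter/test_fun_continuous.
    have cpsi0 : psi x @[x --> 0^'+] --> psi 0.
      exact/cvg_at_right_filter/(@test_fun_continuous _ psi 0).
    have cphi0 : phi x @[x --> 0^'+] --> (0:R).
      by have := cphi 0 => /cvg_at_right_filter; rewrite (phi0 0).
    (* A nonzero limit would be a jump of phi', that is, a Dirac mass at 0 in phi''. *)
    have cphi1 : phi1 x @[x --> 0^'+] --> (0:R).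
      apply/norm_cvg0P.
      apply: (@squeeze_cvgr _ _ _ _ (cst 0) (fun x => K1 * x `^ (alpha - 1))).
      + near=> x.
        have x0 : 0 < x by near: x; exact: nbhs_right_gt.
        have xt0 : x < t0 by near: x; exact: nbhs_right_lt.
        have xt : 0 < x < t0 by rewrite x0.
        by rewrite normr_ge0/=; have [] := bounds x xt.
      + exact: cvg_cst.
      + rewrite -[X in _ --> X](mulr0 K1); apply: cvgM; first exact: cvg_cst.
        exact: powR_cvg0.
    apply: cvgB.
      by rewrite -[X in _ --> X](mul0r (derive1n 1 psi 0)); exact: cvgM.
    by rewrite -[X in _ --> X](mul0r (psi 0)); exact: cvgM.
  - have mI : measurable (`[0%R, L]%classic : set (measurableTypeR R)) by [].
    exact: (integrableB mI i1 i2).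
by rewrite FL F0 subrr.
Unshelve. all: by end_near. Qed.

End C1.

(** Both d(phi(t)) and b(phi(t - tau)) lie between 0 and the bound, hence so does their distance.
    The delayed term is zero or controlled at an earlier time, where the power is smaller. *)
Lemma reaction_bound (R : realType) (kappa K B alpha t1 tau : R)
    (b d d' phi : R -> R) :
  0 <= tau -> 0 <= alpha -> 0 <= K ->
  C1_on_halfline d d' -> d 0 = 0 -> (forall s, 0 < s -> 0 < d' s) ->
  (forall s, 0 <= s -> 0 <= b s) -> b 0 = 0 ->
  (forall s, 0 < s < kappa -> d s < b s /\ b s <= K * s) ->
  (forall t, t <= 0 -> phi t = 0) -> (forall t, 0 < t -> 0 < phi t) ->
  (forall t, 0 < t < t1 -> phi t < kappa /\ phi t <= B * t `^ alpha) ->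
  forall t, 0 < t < t1 ->
    `|d (phi t) - b (phi (t - tau))| <= K * B * t `^ alpha.
Proof.
move=> tau0 alpha0 K0 [cd [_ dd]] d0 d'pos b_ge0 b0 Hdb phi0 phi_gt0 Hphi t tt.
have /andP[tp tt1] := tt.
have d_ge0 s : 0 < s -> 0 <= d s.
  move=> s0.
  have ds (x : R) : x \in `]0, s[ -> is_derive x 1 d (d' x).
    by rewrite in_itv/= => /andP[x0 _]; exact: dd.
  have cds : {within `[0, s], continuous d}.
    by apply: continuous_subspaceW cd => x; rewrite /= !in_itv/= => /andP[->].
  have [x] := MVT s0 ds cds.
  rewrite in_itv/= d0 !subr0 => /andP[x0 _] ->.
  by rewrite mulr_ge0// ltW// d'pos.
have bound s : 0 < s < t1 -> K * phi s <= K * B * s `^ alpha.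
  by move=> ss; have [_ h] := Hphi s ss; rewrite -mulrA ler_wpM2l.
(* Monotonicity needs [K * B] nonnegative; a negative value would contradict phi(t) > 0. *)
have KB t' : 0 < t' <= t -> K * B * t' `^ alpha <= K * B * t `^ alpha.
  move=> /andP[t'0 t't].
  have [KB0|KB0] := leP 0 (K * B).
    by rewrite ler_wpM2l//; apply: ge0_ler_powR => //; rewrite nnegrE ltW.
  have := bound t tt; have pt : 0 <= K * phi t by rewrite mulr_ge0// ltW// phi_gt0.
  have := powR_gt0 alpha tp => p0 /(le_trans pt).
  by rewrite pmulr_lge0// leNgt KB0.
have hd : 0 <= d (phi t) <= K * B * t `^ alpha.
  rewrite d_ge0 ?phi_gt0//=; apply: le_trans (bound t tt).
  have [pk _] := Hphi t tt; have [|/ltW h1 h2] := Hdb (phi t).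
    by rewrite phi_gt0.
  exact: le_trans h2.
have hb : 0 <= b (phi (t - tau)) <= K * B * t `^ alpha.
  have [s0|s0] := leP (t - tau) 0.
    by rewrite phi0// b0 lexx/=; have /andP[h1 h2] := hd; exact: le_trans h2.
  have ss : 0 < t - tau < t1 by rewrite s0/=; lra.
  rewrite (b_ge0 _ (ltW (phi_gt0 _ s0)))/=.
  have [pk _] := Hphi _ ss; have [|_ h2] := Hdb (phi (t - tau)).
    by rewrite phi_gt0.
  apply: (le_trans h2); apply: (le_trans (bound _ ss)).
  by apply: KB; rewrite s0/=; lra.
by rewrite ler_norml; lra.
Qed.

Theorem theorem2p4 (R : realType) (m D r : R)
  (b d b' d' d'' : R -> R) (kappa sM zeta1 zeta2 : R)
  (* parameters *)
  (Hm : 1 < m) (HD : 0 < D) (Hr : 0 <= r)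
  (* death rate d in C^2([0,+oo)), d(0) = 0, d' > 0 and d'' >= 0 on (0,+oo) *)
  (Hd1 : C1_on_halfline d d') (Hd2 : C1_on_halfline d' d'')
  (Hd0 : d 0 = 0)
  (Hd'pos : forall s, 0 < s -> 0 < d' s)
  (Hd''nneg : forall s, 0 < s -> 0 <= d'' s)
  (* birth rate b in C^1([0,+oo); [0,+oo)) *)
  (Hb1 : C1_on_halfline b b')
  (Hbnneg : forall s, 0 <= s -> 0 <= b s)
  (* s_M is the unique positive local extremum point of b, and its global maximum point *)
  (HsM : 0 < sM) (HsMloc : local_max b sM)
  (HsMglob : forall s, 0 <= s -> b s <= b sM)
  (HsMuniq : forall s, 0 < s -> local_max b s \/ local_min b s -> s = sM)
  (Hb0 : b 0 = 0)
  (Hkappa : 0 < kappa) (Hbdkappa : b kappa = d kappa)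
  (Hb'd'0 : d' 0 < b' 0) (Hb'd'kappa : b' kappa < d' kappa)
  (Hdb : forall s, 0 < s < kappa -> d s < b s /\ b s <= b' 0 * s)
  (HsMkappa : sM < kappa)
  (* zeta2 = d^{-1}(M) with M = b(s_M) ; zeta1 in (0, s_M) with b(zeta1) = theta := b(zeta2) *)
  (Hzeta2 : 0 <= zeta2 /\ d zeta2 = b sM)
  (Hzeta1 : 0 < zeta1 < sM /\ b zeta1 = b zeta2) :
  forall (c : R) (phi : R -> R),
    0 < c ->
    semi_wavefront m D r c kappa b d phi ->
    (forall t, t <= 0 -> phi t = 0) ->
    (forall t, 0 < t -> 0 < phi t) ->
    (zeta1%:E <= liminf_pinfty phi)%E ->
    (limsup_pinfty phi <= zeta2%:E)%E ->
    (exists Lambda C1 C2 : R,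
       [/\ 1 / (m - 1) < Lambda, 0 < C1, 0 < C2 &
        forall t, 0 < t < 1 ->
          `|phi t - C1 * t `^ (1 / (m - 1))| <= C2 * t `^ Lambda]) ->
    (2 <= m -> sharp_nonC1_type phi) /\ (m < 2 -> sharp_C1_type phi).
Proof.
move=> c phi c0 [phi_ge0 [cphi [_ [_ [_ [weq _]]]]]] phi0 phi_gt0 _ _.
move=> [Lambda [C1 [C2 [aL C10 C20 Hexp]]]].
have m10 : 0 < m - 1 by lra.
have shp : sharp phi by exists 0.
have [t0 [/andP[t00 t01] bphi]] := power_expansion_bounds aL C10 C20 Hexp.
have A0 : 0 < C1 / 2 by rewrite divr_gt0.
split=> m2; split=> //.
  (* For m >= 2 the exponent 1/(m-1) is at most 1, so t <= t^(1/(m-1)) on (0, 1]. *)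
  apply: (@not_second_deriv_L1loc R phi (C1 / 2) t0) => // t tt.
  have /andP[tp tt0] := tt; have /andP[lo _] := bphi t tt.
  apply: le_trans lo; rewrite ler_pM2l// ger1_powR//; first by rewrite tp/=; lra.
  by rewrite ler_pdivrMr//; lra.
have [cd [_ dd]] := Hd1; have [cb _] := Hb1.
have [ch [H [dH H0 dW]]] :=
  wave_profile_derive Hm Hr c0 cd Hd0 cb Hb0 cphi phi_ge0 phi0 weq.
(* The comparison d(s) < b(s) <= b'(0) s holds only below [kappa]. *)
have [e /= e0 He] : \forall t \near (0:R), phi t < kappa.
  by have := cphi 0 => /cvgr_lt; apply; rewrite phi0.
pose t1 := Num.min t0 e.
have t10 : 0 < t1 by rewrite lt_min t00.
have t1P t : 0 < t < t1 -> 0 < t < t0 /\ phi t < kappa.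
  move=> /andP[tp]; rewrite lt_min => /andP[tt0 te]; rewrite tp; split => //.
  by apply: He; rewrite /= sub0r normrN gtr0_norm.
(* Evaluate 0 <= b(s) <= b'(0) s at s = kappa/2. *)
have b'0 : 0 <= b' 0.
  have k2 : 0 < kappa / 2 < kappa by rewrite divr_gt0//=; lra.
  have [_ h2] := Hdb _ k2; have /andP[k0 _] := k2.
  by have := le_trans (Hbnneg _ (ltW k0)) h2; rewrite pmulr_lge0.
apply: (@profile_second_deriv_L1loc R m D c (C1 / 2) (C1 + C2)
  (b' 0 * (C1 + C2)) t1 phi _ H Hm m2 HD c0 A0 _ _ _ cphi phi0 phi_gt0 ch dH H0 dW).
- by rewrite addr_ge0// ltW.
- by rewrite mulr_ge0// addr_ge0// ltW.
- by rewrite t10/= ge_min t01.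
- by move=> t /t1P[tt _]; exact: bphi.
- apply: (@reaction_bound R kappa _ _ _ _ _ b d d') => //.
  + by rewrite mulr_ge0// ltW.
  + by rewrite divr_ge0// ltW.
  + by move=> t /t1P[tt pk]; split => //; have /andP[] := bphi t tt.
Qed.
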